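(* For any set $\Omega$, the free left ample monoid $\mathrm{FLA}(\Omega)$ is right coherent.
   Context: Free left ample monoid: let $\Omega^*$ be the free monoid on $\Omega$, with empty word $\epsilon$. A subset $A\subseteq\Omega^*$ is prefix closed if every prefix of every element of $A$ lies in $A$. Then $\mathrm{FLA}(\Omega)=\{(A,a): A\subseteq \Omega^*\text{ finite and prefix closed},\ a\in A\}$, with product $(A,a)(B,b)=(A\cup aB,ab)$ and identity $(\{\epsilon\},\epsilon)$. Coherency: for a monoid $S$, a right $S$-act is a set $A$ with a map $A\times S\to A$, $(a,s)\mapsto as$, such that $a1=a$ and $a(st)=(as)t$ for all $a\in A$, $s,t\in S$ (the empty act is allowed). A right $S$-act is finitely presented if it is isomorphic to a quotient of a finitely generated free right $S$-act by a finitely generated congruence. The monoid $S$ is right coherent if every finitely generated subact of every finitely presented right $S$-act is finitely presented. *)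

(* Defs.v *)
From HB Require Import structures.
From mathcomp Require Import all_boot generic_quotient.
From mathcomp Require Import boolp classical_sets functions cardinality.

Set Implicit Arguments.
Unset Strict Implicit.
Unset Printing Implicit Defensive.

Local Open Scope classical_set_scope.
Local Open Scope group_scope.

HB.mixin Record isRightAct (S : monoidType) (A : Type) := {
  ract : A -> S -> A;
  ract1 : forall a, ract a 1 = a;
  ractM : forall a s t, ract a (s * t) = ract (ract a s) t
}.

#[short(type="rightActType")]
HB.structure Definition RightAct (S : monoidType) :=
  {A of isRightAct S A & Choice A}.

(* As for monoidType, carriers are choiceTypes; classically this excludes no
   set (gen_choiceMixin). The empty act is allowed. *)

Definition ract_isomorphic (S : monoidType) (A B : rightActType S) : Prop :=
  exists f : A -> B,
    bijective f /\ forall a (s : S), f (ract a s) = ract (f a) s.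

Record subact (S : monoidType) (A : rightActType S) := Subact {
  subact_set :> set A;
  subact_closed : forall a (s : S), subact_set a -> subact_set (ract a s)
}.

Definition subact_gen (S : monoidType) (A : rightActType S) (U : set A) :
  set A := [set ract u s | u in U & s in [set: S]].

Definition subact_fin_gen (S : monoidType) (A : rightActType S)
    (B : subact A) : Prop :=
  exists U : set A, finite_set U /\ B = subact_gen U :> set A.

Definition subact_type (S : monoidType) (A : rightActType S) (B : subact A) :
  Type := set_type B.

Section SubactAct.
Variables (S : monoidType) (A : rightActType S) (B : subact A).

HB.instance Definition _ := Choice.on (subact_type B).

Definition subact_ract (b : subact_type B) (s : S) : subact_type B :=
  SigSub (mem_set (subact_closed s (set_mem (valP b)))).

Fact subact_ract1 b : subact_ract b 1 = b.
Proof. by apply: val_inj; rewrite /= ract1. Qed.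

Fact subact_ractM b s t :
  subact_ract b (s * t) = subact_ract (subact_ract b s) t.
Proof. by apply: val_inj; rewrite /= ractM. Qed.

HB.instance Definition _ :=
  isRightAct.Build S (subact_type B) subact_ract1 subact_ractM.
End SubactAct.

Definition is_congruence (S : monoidType) (A : rightActType S) :
    set (set (A * A)) := [set rho |
  [/\ forall a, rho (a, a),
      forall a b, rho (a, b) -> rho (b, a),
      forall a b c, rho (a, b) -> rho (b, c) -> rho (a, c) &
      forall a b (s : S), rho (a, b) -> rho (ract a s, ract b s)]].

Record congruence (S : monoidType) (A : rightActType S) := Congruence {
  cong_set :> set (A * A);
  congP : is_congruence cong_set
}.

Definition cong_fin_gen (S : monoidType) (A : rightActType S)
    (rho : congruence A) : Prop :=
  exists H : set (A * A),
    finite_set H /\ rho = smallest (@is_congruence S A) H :> set (A * A).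

Section Quotient.
Variables (S : monoidType) (A : rightActType S) (rho : congruence A).

Definition cong_rel : rel A := fun a b => (a, b) \in (rho : set (A * A)).

Fact cong_rel_refl : reflexive cong_rel.
Proof. by case: (congP rho) => r _ _ _ a; apply/mem_set/r. Qed.

Fact cong_rel_sym : symmetric cong_rel.
Proof.
by case: (congP rho) => _ s _ _ a b; apply/idP/idP => /set_mem/s/mem_set.
Qed.

Fact cong_rel_trans : transitive cong_rel.
Proof.
case: (congP rho) => _ _ t _ b a c /set_mem ab /set_mem bc.
exact/mem_set/(t _ _ _ ab bc).
Qed.

Canonical cong_equiv : equiv_rel A :=
  EquivRel cong_rel cong_rel_refl cong_rel_sym cong_rel_trans.

Definition quot_act : Type := {eq_quot cong_equiv}%qT.

HB.instance Definition _ := Choice.on quot_act.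
HB.instance Definition _ := EqQuotient.on quot_act.

Definition quot_ract (q : quot_act) (s : S) : quot_act :=
  \pi_quot_act%qT (ract (repr q) s).

(* The operation does not depend on the representative chosen by repr. *)
Lemma quot_ract_pi (a : A) (s : S) :
  quot_ract (\pi_quot_act%qT a) s = \pi_quot_act%qT (ract a s).
Proof.
have /set_mem ra : cong_rel (repr (\pi_quot_act%qT a)) a.
  by apply/eqmodP; rewrite reprK.
by apply/eqmodP/mem_set; case: (congP rho) => _ _ _; apply.
Qed.

Fact quot_ract1 q : quot_ract q 1 = q.
Proof. by rewrite /quot_ract ract1 reprK. Qed.

Fact quot_ractM q s t : quot_ract q (s * t) = quot_ract (quot_ract q s) t.
Proof. by rewrite {3}/quot_ract quot_ract_pi -ractM. Qed.

HB.instance Definition _ := isRightAct.Build S quot_act quot_ract1 quot_ractM.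
End Quotient.

Definition free_act (S : monoidType) (X : Type) : Type := (X * S)%type.

Section FreeAct.
Variables (S : monoidType) (X : choiceType).

HB.instance Definition _ := Choice.on (free_act S X).

Definition free_ract (a : free_act S X) (s : S) : free_act S X :=
  (a.1, a.2 * s).

Fact free_ract1 a : free_ract a 1 = a.
Proof. by case: a => x t; rewrite /free_ract mulg1. Qed.

Fact free_ractM a s t : free_ract a (s * t) = free_ract (free_ract a s) t.
Proof. by rewrite /free_ract mulgA. Qed.

HB.instance Definition _ :=
  isRightAct.Build S (free_act S X) free_ract1 free_ractM.
End FreeAct.

Definition finitely_presented (S : monoidType) (A : rightActType S) : Prop :=
  exists (n : nat) (rho : congruence (free_act S 'I_n)),
    cong_fin_gen rho /\ ract_isomorphic A (quot_act rho).

Definition right_coherent (S : monoidType) : Prop :=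
  forall A : rightActType S, finitely_presented A ->
  forall B : subact A, subact_fin_gen B -> finitely_presented (subact_type B).

Definition prefix_closed (Omega : Type) (A : set (seq Omega)) : Prop :=
  forall u v, A (u ++ v) -> A u.

Record FLA (Omega : Type) := MkFLA {
  fla_set : set (seq Omega);
  fla_word : seq Omega;
  fla_finite : finite_set fla_set;
  fla_prefix_closed : prefix_closed fla_set;
  fla_mem : fla_set fla_word
}.

Section FLAMonoid.
Variable Omega : Type.
Implicit Types p q r : FLA Omega.

Lemma fla_inj p q :
  fla_set p = fla_set q -> fla_word p = fla_word q -> p = q.
Proof.
case: p q => [A a fA pA Aa] [B b fB pB Bb] /= eAB eab.
by subst; congr MkFLA; exact: Prop_irrelevance.
Qed.

HB.instance Definition _ := gen_eqMixin (FLA Omega).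
HB.instance Definition _ := gen_choiceMixin (FLA Omega).

Definition fla_mul_set p q : set (seq Omega) :=
  fla_set p `|` [set fla_word p ++ w | w in fla_set q].

Fact fla_mul_finite p q : finite_set (fla_mul_set p q).
Proof.
by rewrite finite_setU; split; [|apply: finite_image]; exact: fla_finite.
Qed.

Fact fla_mul_prefix_closed p q : prefix_closed (fla_mul_set p q).
Proof.
move=> u v [/fla_prefix_closed|[w qw]]; first by left.
move=> /(congr1 (take (size u))); rewrite (@take_size_cat _ _ u) // take_cat.
case: ltnP => _ <-.
  left; apply: (@fla_prefix_closed _ p _ (drop (size u) (fla_word p))).
  by rewrite cat_take_drop; exact: fla_mem.
right; exists (take (size u - size (fla_word p)) w) => //.
apply: (@fla_prefix_closed _ q _ (drop (size u - size (fla_word p)) w)).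
by rewrite cat_take_drop.
Qed.

Fact fla_mul_mem p q : fla_mul_set p q (fla_word p ++ fla_word q).
Proof. by right; exists (fla_word q) => //; exact: fla_mem. Qed.

Definition fla_mul p q : FLA Omega :=
  MkFLA (@fla_mul_finite p q) (@fla_mul_prefix_closed p q) (fla_mul_mem p q).

Fact fla_one_prefix_closed : prefix_closed [set [::] : seq Omega].
Proof. by move=> [|x u] v. Qed.

Definition fla_one : FLA Omega :=
  MkFLA (finite_set1 [::]) fla_one_prefix_closed (erefl [::]).

Lemma fla_nil p : fla_set p [::].
Proof. exact: (@fla_prefix_closed _ p [::] (fla_word p) (fla_mem p)). Qed.

Fact fla_mulA : associative fla_mul.
Proof.
move=> p q r; apply: fla_inj => /=; last by rewrite catA.
rewrite /fla_mul_set /= /fla_mul_set image_setU setUA; congr (_ `|` _).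
by rewrite image_comp; apply: eq_imagel => w _ /=; rewrite catA.
Qed.

Fact fla_mul1 : left_id fla_one fla_mul.
Proof.
move=> p; apply: fla_inj => //=; rewrite /fla_mul_set /= image_id.
by apply/setUidPr => _ ->; exact: fla_nil.
Qed.

Fact fla_mul1r : right_id fla_one fla_mul.
Proof.
move=> p; apply: fla_inj => /=; last by rewrite cats0.
rewrite /fla_mul_set /= image_set1 cats0.
by apply/setUidPl => _ ->; exact: fla_mem.
Qed.

HB.instance Definition _ :=
  isMonoid.Build (FLA Omega) fla_mulA fla_mul1 fla_mul1r.
End FLAMonoid.

(* Main.v *)
Require Import Defs.
From HB Require Import structures.
From mathcomp Require Import all_boot finmap generic_quotient zify.
From mathcomp Require Import boolp classical_sets functions cardinality.

(** By right translation it suffices to show that, for finitely many generators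
    x_i of an act given by a finite set H of relations, the relations holding
    between the elements x_i s follow from finitely many of them.  Bound the words
    in H by a weight.  If (A, a) is not bounded, take a heaviest leaf l of A and
    let m be the branching point of a and l, so that (A, a) = (A \ l, m) W.
    Along a chain of H-steps, l stays a heaviest leaf until the moment when the
    whole tree is bounded, because pieces glued to the tree are bounded and all
    other words are translated together with l.  Hence a chain between
    unbounded elements either can be cancelled by W, or visits a bounded
    element at which W is bounded too; in both cases induction on the size of A
    reduces the relation to those between bounded translates of
    representatives of the finitely many bounded elements. *)

Set Implicit Arguments.
Unset Strict Implicit.
Unset Printing Implicit Defensive.

Local Open Scope classical_set_scope.
Local Open Scope group_scope.

Section Trimming.
Variable Omega : choiceType.
Implicit Types (u v w l m al lam : seq Omega) (p q t c d W : FLA Omega).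

Lemma fla_mulE p q : p * q = fla_mul p q. Proof. by []. Qed.

Definition prefixes lam al : set (seq Omega) :=
  [set w | prefix w lam \/ prefix w al].

Lemma finite_prefixes lam al : finite_set (prefixes lam al).
Proof.
suff fin1 l : finite_set [set w | prefix w l].
  have := conj (fin1 lam) (fin1 al); rewrite -finite_setU.
  by apply: sub_finite_set => w []; [left|right].
apply: (sub_finite_set (B := [set take k l | k in `I_(size l).+1])).
  move=> w /prefixP[v ->]; exists (size w); last exact: take_size_cat.
  by rewrite /= size_cat ltnS leq_addr.
exact/finite_image/finite_II.
Qed.

Lemma prefixes_closed lam al : prefix_closed (prefixes lam al).
Proof.
have pre l u v : prefix (u ++ v) l -> prefix u l.
  by move=> /prefixP[w ->]; rewrite -catA prefix_prefix.
by move=> u v [] /pre; [left|right].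
Qed.

Definition prefix_fla lam al : FLA Omega :=
  MkFLA (finite_prefixes lam al) (@prefixes_closed lam al)
    (or_intror (prefix_refl al)).

Definition trims p q m lam :=
  fla_word q = m /\ fla_set q = fla_set p `\ (m ++ lam).

Lemma trims_mul p q m lam al :
  fla_set p (m ++ lam) -> fla_word p = m ++ al -> trims p q m lam ->
  p = q * prefix_fla lam al.
Proof.
move=> plam pal [qm qE]; apply: fla_inj; rewrite fla_mulE /= ?qm //.
rewrite /fla_mul_set /= qm qE; apply/seteqP; split=> [w pw|w [[]//|]].
  have [->|/eqP neq] := eqVneq w (m ++ lam); last by left; split.
  by right; exists lam => //; left; exact: prefix_refl.
move=> [x [] /prefixP[y yE] <-]; apply: (@fla_prefix_closed _ p _ y).
  by rewrite -catA -yE.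
by rewrite -catA -yE -pal; exact: fla_mem.
Qed.

Lemma trims_mull c p q m lam :
  ~ fla_set c (fla_word c ++ m ++ lam) -> trims p q m lam ->
  trims (c * p) (c * q) (fla_word c ++ m) lam.
Proof.
move=> cN [qm qE]; split; rewrite fla_mulE /= ?qm //.
rewrite /fla_mul_set /= qE -catA; apply/seteqP; split=> [w [cw|]|w [[cw|]]].
- by split; [left|move=> /= E; apply: cN; rewrite -E].
- move=> [x [px /= xN] <-]; split; first by right; exists x.
  by move=> /(congr1 (drop (size (fla_word c)))); rewrite !drop_size_cat.
- by left.
move=> [x px <-] xN; right; exists x => //; split=> // xE.
by apply: xN; rewrite xE.
Qed.

Lemma trims_inj p q q' m lam : trims p q m lam -> trims p q' m lam -> q = q'.
Proof.
by move=> [qm qE] [qm' qE']; apply: fla_inj; [rewrite qE|rewrite qm].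
Qed.

Lemma card_trims p q m lam :
  fla_set p (m ++ lam) -> trims p q m lam ->
  (#|` fset_set (fla_set q)| < #|` fset_set (fla_set p)|)%N.
Proof.
move=> pl [_ ->]; have fp := fla_finite p.
rewrite fset_setD1 // [X in (_ < X)%N](cardfsD1 (m ++ lam)).
by rewrite in_fset_set // mem_set.
Qed.

(* [al] leaves [lam] strictly before its last letter: below the branching point
   of [m ++ al] and [m ++ lam] there is no common prefix except possibly
   [lam] itself. *)
Definition branching lam al := lam <> [::] /\
  forall w, prefix w lam -> prefix w al -> w <> lam -> w = [::].

Lemma branching_exists l u : l <> [::] ->
  exists m lam al, [/\ l = m ++ lam, u = m ++ al & branching lam al].
Proof.
elim: l u => [//|y l IH] u _.
have stop : (forall w, prefix w (y :: l) -> prefix w u -> w <> y :: l ->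
    w = [::]) -> exists m lam al,
    [/\ y :: l = m ++ lam, u = m ++ al & branching lam al].
  by move=> J; exists [::], (y :: l), u; split=> //; split.
case: u stop => [|z u] stop; first by apply: stop => -[].
have [zy|zy] := eqVneq z y; last first.
  apply: stop => -[|x w] //=; case: eqP => // -> _.
  by rewrite eq_sym (negPf zy).
have [l0|/eqP lN] := eqVneq l [::].
  by apply: stop; rewrite l0 => -[|x []] //=; case: eqP => // ->.
have [m [lam [al [-> -> J]]]] := IH u lN.
by exists (y :: m), lam, al; rewrite zy.
Qed.

Variable Sg : seq Omega.

(* Letters outside [Sg] are so heavy that the words of weight at most
   [size Sg] form a finite set, although [Omega] may be infinite. *)
Definition weight w := (size w + (size Sg).+1 * count [predC Sg] w)%N.

Definition light : set (seq Omega) := [set w | (weight w <= size Sg)%N].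

Definition bounded p := fla_set p `<=` light.

Lemma weight_cat u v : weight (u ++ v) = (weight u + weight v)%N.
Proof. by rewrite /weight size_cat count_cat; lia. Qed.

Lemma weight_gt0 w : w <> [::] -> (0 < weight w)%N.
Proof. by case: w. Qed.

Lemma light_nil : light [::].
Proof. by rewrite /light /= /weight muln0. Qed.

Lemma finite_light : finite_set light.
Proof.
suff fin n : finite_set [set w | (size w <= n)%N /\ all (mem Sg) w].
  apply: sub_finite_set (fin (size Sg)) => w; rewrite /light /weight /= => H.
  split; first by lia.
  have : count [predC Sg] w = 0 by move: H; case: (count _ _) => //; lia.
  by move/eqP; rewrite -leqn0 leqNgt -has_count has_predC negbK.
elim: n => [|n IH].
  apply: sub_finite_set (finite_set1 [::]) => w [].
  by rewrite leqn0 => /nilP ->.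
have fSg : finite_set [set` Sg] by apply/finite_seqP; exists Sg.
apply: (sub_finite_set (B := [set [::]] `|` [set x :: w |
    x in [set` Sg] & w in [set w | (size w <= n)%N /\ all (mem Sg) w]])).
  move=> [|x w] [] /= sw; first by left.
  by move=> /andP[xS wS]; right; exists x => //; exists w.
by rewrite finite_setU; split; [exact: finite_set1|exact: finite_image2].
Qed.

Lemma finite_bounded : finite_set bounded.
Proof.
have [/= A lA] := finite_fsetP.1 finite_light.
pose C := [set (B, w) | B in [set` fpowerset A] & w in [set` A]].
have fin : finite_set C by exact: finite_image2.
pose f p := (fset_set (fla_set p), fla_word p).
apply: (sub_finite_set (B := f @^-1` C)).
  move=> p bp; exists (fset_set (fla_set p)).
    rewrite /= fpowersetE; apply/fsubsetP => w.
    rewrite in_fset_set ?inE; last exact: fla_finite.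
    by move=> /bp; rewrite lA.
  by exists (fla_word p) => //; have /bp := fla_mem p; rewrite lA.
apply: finite_preimage => // p q _ _ [] E /fla_inj; apply.
by apply: fset_set_inj E; exact: fla_finite.
Qed.

Definition peak p l := [/\ fla_set p l, ~ light l &
  forall w, fla_set p w -> (weight w <= weight l)%N].

Lemma peak_exists p : ~ bounded p -> exists l, peak p l.
Proof.
move=> /existsNP[w0 /not_implyP[pw0 w0N]].
have [/= A lA] := finite_fsetP.1 (fla_finite p).
have A0 : w0 \in A by have := pw0; rewrite lA.
have [//|x _ xmax] :=
  @arg_maxnP _ [` A0]%fset xpredT (fun x : A => weight (val x)).
have xM w : fla_set p w -> (weight w <= weight (val x))%N.
  by rewrite lA => /= wA; have := xmax [` wA]%fset isT.
exists (val x); split=> //; first by rewrite lA; exact: (valP x).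
by move=> xL; apply: w0N; apply: leq_trans xL; exact: xM.
Qed.

Lemma trims_exists p m lam : lam <> [::] -> fla_set p (m ++ lam) ->
  (forall w, fla_set p w -> (weight w <= weight (m ++ lam))%N) ->
  exists q, trims p q m lam.
Proof.
move=> lam0 pl pmax.
have fD : finite_set (fla_set p `\ (m ++ lam)).
  exact/finite_setD/fla_finite.
have pD : prefix_closed (fla_set p `\ (m ++ lam)).
  move=> u v [puv /= uvN]; split; first exact: fla_prefix_closed puv.
  move=> uE; have := pmax _ puv; rewrite uE weight_cat.
  have [v0|/eqP/weight_gt0] := eqVneq v [::]; last by lia.
  by case: uvN; rewrite v0 cats0.
have mD : (fla_set p `\ (m ++ lam)) m.
  split; first exact: fla_prefix_closed pl.
  move=> /= /(congr1 size); rewrite size_cat.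
  by case: lam lam0 {pl pmax fD pD} => //= *; lia.
by exists (MkFLA fD pD mD).
Qed.

(* A heaviest word of [c * t] can only stem from [t], at the end of which it
   survives the replacement of [c] by [d] until all of [d * t] is light. *)
Lemma trims_step c d t q m lam al : bounded c -> bounded d ->
  branching lam al -> peak (c * t) (m ++ lam) ->
  fla_word (c * t) = m ++ al -> trims (c * t) q m lam ->
  exists2 t', q = c * t' & d * t = d * t' * prefix_fla lam al /\
    ((exists m', [/\ peak (d * t) (m' ++ lam), fla_word (d * t) = m' ++ al &
        trims (d * t) (d * t') m' lam]) \/
     [/\ bounded (d * t'), bounded (prefix_fla lam al) & bounded (d * t)]).
Proof.
move=> bc bd [lam0 J] [ctl lN ctmax] ctal tr.
have cN : ~ fla_set c (m ++ lam) by move/bc.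
have [x tx xE] : [set fla_word c ++ w | w in fla_set t] (m ++ lam).
  by case: ctl => // /cN.
have [mu mE] : exists mu, m = fla_word c ++ mu.
  have /prefixP[z zE] : prefix (fla_word c) (m ++ lam).
    by rewrite -xE prefix_prefix.
  have pca : prefix (fla_word c) (m ++ al) by rewrite -ctal prefix_prefix.
  have [cm|/ltnW cm] := leqP (size (fla_word c)) (size m).
    exists (drop (size (fla_word c)) m).
    by have := congr1 (take (size (fla_word c))) zE;
       rewrite [LHS]takel_cat // take_size_cat // => {1}<-;
       rewrite cat_take_drop.
  have [y cE] : exists y, fla_word c = m ++ y.
    exists (drop (size m) (fla_word c)).
    by have := congr1 (take (size m)) zE;
       rewrite [LHS]take_size_cat // takel_cat // => {1}->;
       rewrite cat_take_drop.
  exists [::]; rewrite cats0 cE (J y) ?cats0 //.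
  - move/eqP: zE; rewrite cE -catA eqseq_cat // => /andP[_ /eqP ->].
    exact: prefix_prefix.
  - by move: pca; rewrite cE prefix_catr // eqxx.
  by move=> yE; apply: cN; rewrite -yE -cE; exact: fla_mem.
have tl : fla_set t (mu ++ lam).
  by move: xE; rewrite mE -catA => /eqP;
     rewrite eqseq_cat // => /andP[_ /eqP <-].
have tal : fla_word t = mu ++ al.
  by move: ctal; rewrite fla_mulE mE /= -catA => /eqP;
     rewrite eqseq_cat // => /andP[_ /eqP <-].
have tmax w : fla_set t w -> (weight w <= weight (mu ++ lam))%N.
  move=> tw; have := ctmax (fla_word c ++ w); rewrite mE -catA.
  by rewrite !(weight_cat (fla_word c)) leq_add2l; apply; right; exists w.
have tD : fla_set (d * t) ((fla_word d ++ mu) ++ lam).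
  by right; exists (mu ++ lam); rewrite ?catA.
have talD : fla_word (d * t) = (fla_word d ++ mu) ++ al.
  by rewrite fla_mulE /= tal catA.
have [t' tt'] : exists t', trims t t' mu lam.
  exact: trims_exists.
have ct' : trims (c * t) (c * t') m lam.
  by rewrite mE; apply: trims_mull tt'; rewrite catA -mE.
exists t'; first exact: trims_inj tr ct'.
have dtE : d * t = d * t' * prefix_fla lam al.
  by rewrite -mulgA -(trims_mul tl tal tt').
split=> //.
have wD w : fla_set (d * t) w ->
    light w \/ (weight w <= weight ((fla_word d ++ mu) ++ lam))%N.
  move=> [/bd|[x' /tmax xM <-]]; [by left|right].
  by rewrite -catA !(weight_cat (fla_word d)) leq_add2l.
have [dL|dN] := pselect (light ((fla_word d ++ mu) ++ lam)).
  right; have bdt : bounded (d * t).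
    by move=> w /wD[//|/leq_trans]; apply.
  split=> // w; first by move=> dt'w; apply: bdt; rewrite dtE; left.
  move=> /= Ww; have : light (fla_word (d * t') ++ w).
    by apply: bdt; rewrite dtE; right; exists w.
  by rewrite /light /= weight_cat; apply: leq_trans; exact: leq_addl.
left; exists (fla_word d ++ mu); split=> //.
  split=> // w /wD[wL|//]; apply: leq_trans wL _.
  by rewrite leqNgt; apply/negP => /ltnW.
by apply: trims_mull tt'; rewrite catA => /bd.
Qed.
End Trimming.

Section Chains.
Variables (S : monoidType) (A : rightActType S).
Implicit Types (H : set (A * A)) (a b c d : A).

Inductive chain H : A -> A -> Prop :=
| chain_refl a : chain H a a
| chain_step c d s b : H (c, d) \/ H (d, c) -> chain H (ract d s) b ->
    chain H (ract c s) b.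

Lemma chain_trans H a b c : chain H a b -> chain H b c -> chain H a c.
Proof. by elim=> // {}a d s {}b Had _ IH /IH; exact: chain_step Had. Qed.

Lemma chain1 H c d s : H (c, d) \/ H (d, c) -> chain H (ract c s) (ract d s).
Proof. by move=> Hcd; apply: chain_step Hcd _; exact: chain_refl. Qed.

Lemma chain_gen H a b : H (a, b) -> chain H a b.
Proof.
by move=> Hab; rewrite -[a](@ract1 S) -[b](@ract1 S); apply: chain1; left.
Qed.

Lemma chain_sym H a b : chain H a b -> chain H b a.
Proof.
elim=> [?|c d s {}b Hcd _ IH]; first exact: chain_refl.
by apply: chain_trans IH _; apply: chain1; case: Hcd; [right|left].
Qed.

Lemma chain_act H a b s : chain H a b -> chain H (ract a s) (ract b s).
Proof.
elim=> [?|c d t {}b Hcd _ IH]; first exact: chain_refl.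
by rewrite -ractM; apply: chain_step Hcd _; rewrite ractM.
Qed.

Lemma chain_is_congruence H : is_congruence [set ab | chain H ab.1 ab.2].
Proof.
split=> [a|a b|a b c|a b s] /=; first exact: chain_refl.
- exact: chain_sym.
- exact: chain_trans.
exact: chain_act.
Qed.

Lemma chain_sub_congruence H (rho : set (A * A)) : is_congruence rho ->
  H `<=` rho -> forall a b, chain H a b -> rho (a, b).
Proof.
move=> [rr rs rt rm] Hr a b; elim=> // c d s {}b Hcd _; apply: rt; apply: rm.
by case: Hcd => /Hr //; exact: rs.
Qed.

Lemma smallest_congruenceE H :
  smallest (@is_congruence S A) H = [set ab | chain H ab.1 ab.2].
Proof.
apply/seteqP; split=> [ab|[a b] /= Hab rho [rhoC Hr]].
  apply; split; first exact: chain_is_congruence.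
  by move=> [a b]; exact: chain_gen.
exact: chain_sub_congruence Hr _ _ Hab.
Qed.
End Chains.

Section Core.
Variables (Omega : choiceType) (X : finType).
Local Notation F := (free_act (FLA Omega) X).
Variable H : set (F * F).
Variable Sg : seq Omega.
Hypothesis H_bounded : forall c d, H (c, d) -> bounded Sg c.2 /\ bounded Sg d.2.

Local Notation R := (chain H).

Lemma free_ractE (x : X) (s t : FLA Omega) :
  ract ((x, s) : F) t = (x, s * t) :> F.
Proof. by []. Qed.

Lemma chain_trim (u v : F) m lam al (p : FLA Omega) :
  R u v -> branching lam al -> peak Sg u.2 (m ++ lam) ->
  fla_word u.2 = m ++ al -> trims u.2 p m lam ->
  (exists m' q, [/\ peak Sg v.2 (m' ++ lam), fla_word v.2 = m' ++ al,
      trims v.2 q m' lam & R (u.1, p) (v.1, q)]) \/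
  (exists q : F, [/\ bounded Sg q.2, bounded Sg (prefix_fla lam al),
      bounded Sg (ract q (prefix_fla lam al)).2, R (u.1, p) q &
      R (ract q (prefix_fla lam al)) v]).
Proof.
move=> uv J; elim: uv m p => {u v} [u m p pk wu tr|].
  by left; exists m, p; split=> //; exact: chain_refl.
move=> [x c] [y d] t v Hcd dv IH m p pk wu tr.
have [bc bd] : bounded Sg c /\ bounded Sg d by case: Hcd => /H_bounded [].
have [t' pE [dtE]] := trims_step bc bd J pk wu tr.
have step : R (x, p) (y, d * t').
  by rewrite pE -!free_ractE; exact: chain1.
case=> [[m' [pk' wu' tr']]|[b1 b2 b3]].
  have [[m2 [q [? ? ? Rq]]]|[q [? ? ? Rq ?]]] := IH _ _ pk' wu' tr'.
    by left; exists m2, q; split=> //; exact: chain_trans step Rq.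
  by right; exists q; split=> //; exact: chain_trans step Rq.
right; exists (y, d * t'); split=> //=.
  by rewrite -dtE.
by rewrite free_ractE -dtE.
Qed.

Lemma trim_peak (u : FLA Omega) : ~ bounded Sg u ->
  exists m lam al p, [/\ branching lam al, peak Sg u (m ++ lam),
    fla_word u = m ++ al & trims u p m lam].
Proof.
move=> /peak_exists[l pk].
have l0 : l <> [::].
  by move=> l0; case: pk => _; rewrite l0; case; exact: light_nil.
have [m [lam [al [lE uE J]]]] := branching_exists (fla_word u) l0.
rewrite lE in pk; have [p tr] : exists p, trims u p m lam.
  by case: pk J => pl _ pmax [lam0 _]; exact: trims_exists pl pmax.
by exists m, lam, al, p.
Qed.

Variable P : pred X.

(* If no element of [P] reaches [q], then [rep q] is the junk value [q]. *)
Definition rep (q : F) : F := xget q [set u | P u.1 /\ R u q].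

Definition rep_gens : set F :=
  [set u | P u.1] `&`
  ([set u | bounded Sg u.2] `|`
   [set ract (rep q) W | q in [set q | bounded Sg q.2] & W in bounded Sg]).

Definition rep_rels : set (F * F) :=
  (rep_gens `*` rep_gens) `&` [set uv | R uv.1 uv.2].

Lemma repP (q u : F) : P u.1 -> R u q -> P (rep q).1 /\ R (rep q) q.
Proof. by move=> Pu Ru; apply: (@xgetI _ q [set u | P u.1 /\ R u q] u). Qed.

Lemma finite_bounded_free : finite_set [set q : F | bounded Sg q.2].
Proof.
apply: (sub_finite_set (B := [set: X] `*` bounded Sg)); first by move=> [x p].
by apply: finite_setX; [exact: finite_finset|exact: finite_bounded].
Qed.

Lemma finite_rep_rels : finite_set rep_rels.
Proof.
have fin : finite_set rep_gens.
  apply: finite_setIr; rewrite finite_setU; split.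
    exact: finite_bounded_free.
  by apply: finite_image2; [exact: finite_bounded_free|exact: finite_bounded].
by apply: finite_setIl; exact: finite_setX.
Qed.

Lemma bounded1 : bounded Sg 1.
Proof.
by move=> w; rewrite [fla_set 1 w]/([set [::]] w) => ->; exact: light_nil.
Qed.

Variable E : set (F * F).
Hypothesis EC : is_congruence E.
Hypothesis KE : rep_rels `<=` E.

Lemma rep_gens_rep (q u : F) W : bounded Sg q.2 -> bounded Sg W -> P u.1 ->
  R u q -> rep_gens (ract (rep q) W).
Proof.
move=> bq bW Pu /(repP Pu)[Pr _]; split=> //; right.
by exists q => //; exists W.
Qed.

Lemma rep_gens1 (q u : F) : bounded Sg q.2 -> P u.1 -> R u q ->
  rep_gens (rep q).
Proof.
by move=> bq Pu Ru; rewrite -[rep q](ract1 (S := FLA Omega));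
   exact: rep_gens_rep bq bounded1 Pu Ru.
Qed.

Lemma reach_bounded (u q : F) : P u.1 -> bounded Sg q.2 -> R u q ->
  E (u, rep q).
Proof.
have [Er Es Et Em] := EC.
have [k] := ubnP #|` fset_set (fla_set u.2)|.
elim: k => // k IH in u q *; rewrite ltnS => uk Pu bq Ruq.
have [Pr Rr] := repP Pu Ruq.
have [bu|/trim_peak[m [lam [al [p [J pk wu tr]]]]]] := pselect (bounded Sg u.2).
  apply: KE; split; last exact/(chain_trans Ruq)/chain_sym.
  by split; [split=> //; left|exact: rep_gens1 Ruq].
have [[m' [_ [[ql qN _] _ _ _]]]|] := chain_trim Ruq J pk wu tr.
  by case: qN; exact: bq.
move=> [q' [bq' bW bq'W Ruq' Rq'q]].
set W := prefix_fla lam al in bW bq'W Rq'q.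
have [ul _ _] := pk.
have uE : u = ract ((u.1, p) : F) W.
  by rewrite free_ractE -(trims_mul ul wu tr) -surjective_pairing.
have Pp : P (u.1, p).1 by [].
have [Pr' Rr'] := repP Pp Ruq'.
apply: (Et _ (ract (rep q') W)).
  rewrite {1}uE; apply: Em; apply: IH => //.
  by apply: leq_trans uk; exact: card_trims ul tr.
apply: KE; split.
  by split; [exact: rep_gens_rep Ruq'|exact: rep_gens1 Ruq].
apply: chain_trans (chain_act W Rr') _.
by apply: chain_trans Rq'q _; exact: chain_sym.
Qed.

Lemma chain_rep_rels (u v : F) : P u.1 -> P v.1 -> R u v -> E (u, v).
Proof.
have [Er Es Et Em] := EC.
have via u' v' q : P u'.1 -> P v'.1 -> bounded Sg q.2 -> R u' q -> R q v' ->
    E (u', v').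
  move=> Pu Pv bq Ruq Rqv; apply: Et (reach_bounded Pu bq Ruq) _.
  by apply: Es; apply: reach_bounded => //; exact: chain_sym.
have [k] := ubnP #|` fset_set (fla_set u.2)|.
elim: k => // k IH in u v *; rewrite ltnS => uk Pu Pv Ruv.
have [bu|/trim_peak[m [lam [al [p [J pk wu tr]]]]]] := pselect (bounded Sg u.2).
  by apply: via bu _ Ruv => //; exact: chain_refl.
have [ul _ _] := pk.
have uE : u = ract ((u.1, p) : F) (prefix_fla lam al).
  by rewrite free_ractE -(trims_mul ul wu tr) -surjective_pairing.
have [[m' [q [[vl _ _] wv tr' Rpq]]]|] := chain_trim Ruv J pk wu tr.
  have vE : v = ract ((v.1, q) : F) (prefix_fla lam al).
    by rewrite free_ractE -(trims_mul vl wv tr') -surjective_pairing.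
  rewrite uE vE; apply: Em; apply: IH => //=.
  by apply: leq_trans uk; exact: card_trims ul tr.
move=> [q [bq bW bqW Ruq Rqv]]; apply: via bqW _ Rqv => //.
by rewrite uE; exact: chain_act.
Qed.
End Core.

Lemma bounding_letters (Omega : choiceType) (T : Type)
    (H : set (free_act (FLA Omega) T * free_act (FLA Omega) T)) :
  finite_set H -> exists Sg : seq Omega,
    forall c d, H (c, d) -> bounded Sg c.2 /\ bounded Sg d.2.
Proof.
move=> fH.
pose U := \bigcup_(cd in H) (fla_set cd.1.2 `|` fla_set cd.2.2).
have /finite_seqP[s sE] : finite_set U.
  by apply: bigcup_finite => // cd _; rewrite finite_setU;
     split; exact: fla_finite.
have sL : U `<=` light (flatten s).
  move=> w; rewrite sE /light /= /weight => ws.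
  have wS : all (mem (flatten s)) w.
    by apply/allP => x xw; apply/flattenP; exists w.
  have -> : count [predC flatten s] w = 0.
    by apply/eqP; rewrite -leqn0 leqNgt -has_count has_predC negbK.
  rewrite muln0 addn0; elim: s ws {sE wS} => //= v s IH.
  by rewrite inE size_cat => /orP[/eqP->|/IH]; lia.
exists (flatten s) => c d Hcd.
by split=> w cw; apply: sL; exists (c, d) => //; [left|right].
Qed.

Definition kernels_fin_gen (S : monoidType) := forall (n m : nat)
    (g : 'I_m -> free_act S 'I_n)
    (H : set (free_act S 'I_n * free_act S 'I_n)), finite_set H ->
  exists2 K : set (free_act S 'I_m * free_act S 'I_m), finite_set K &
    forall u v, chain K u v <->
      chain H (ract (g u.1) u.2) (ract (g v.1) v.2).

Lemma FLA_kernels_fin_gen (Omega : choiceType) : kernels_fin_gen (FLA Omega).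
Proof.
move=> n m g H fH; set S := FLA Omega.
pose F := free_act S ('I_m + 'I_n)%type.
pose lft (a : free_act S 'I_n) : F := (inr a.1, a.2).
pose inj (a : free_act S 'I_m) : F := (inl a.1, a.2).
pose G : set (F * F) := [set ((inl i, 1), lft (g i)) | i in [set: 'I_m]].
pose H' : set (F * F) := [set (lft cd.1, lft cd.2) | cd in H] `|` G.
pose psi (a : F) : free_act S 'I_n :=
  match a.1 with inl i => ract (g i) a.2 | inr x => (x, a.2) end.
have psi_act a s : psi (ract a s) = ract (psi a) s.
  by case: a => -[i|x] t; rewrite /psi /= ?ractM.
have psi_lft a : psi (lft a) = a by case: a.
have psi_chain a b : chain H' a b -> chain H (psi a) (psi b).
  elim=> [?|c d s {}b Hcd _]; first exact: chain_refl.
  apply: chain_trans; rewrite !psi_act; apply: chain_act.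
  suff gen c' d' : H' (c', d') -> chain H (psi c') (psi d').
    by case: Hcd => /gen // /chain_sym.
  move=> [[[c0 d0] Hcd0 [<- <-]]|[i _ [<- <-]]]; rewrite !psi_lft.
    exact: chain_gen.
  by rewrite /psi /= ract1; exact: chain_refl.
have lft_chain a b : chain H a b -> chain H' (lft a) (lft b).
  elim=> [?|c d s {}b Hcd _]; first exact: chain_refl.
  have lft_act e : lft (ract e s) = ract (lft e) s by [].
  rewrite !lft_act; apply: chain_step.
  by case: Hcd => Hcd; [left|right]; left; [exists (c, d)|exists (d, c)].
have inj_lft u : chain H' (inj u) (lft (ract (g u.1) u.2)).
  have -> : inj u = ract ((inl u.1, 1) : F) u.2 by rewrite free_ractE mul1g.
  have -> : lft (ract (g u.1) u.2) = ract (lft (g u.1)) u.2 by [].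
  by apply: chain1; left; right; exists u.1.
have inj_psi u : psi (inj u) = ract (g u.1) u.2 by [].
have fH' : finite_set H'.
  rewrite finite_setU; split; apply: finite_image => //; exact: finite_finset.
have [Sg Sg_bounded] := bounding_letters fH'.
pose P (x : 'I_m + 'I_n) := if x is inl _ then true else false.
pose K0 := rep_rels H' Sg P.
pose K := [set uv | K0 (inj uv.1, inj uv.2)].
exists K.
  apply: (finite_preimage (f := fun uv => (inj uv.1, inj uv.2))).
    by move=> [[i s] [j t]] [[i' s'] [j' t']] _ _ [-> -> -> ->].
  exact: finite_rep_rels.
move=> u v; split=> [|guv].
  have KR : K `<=` [set uv | chain H' (inj uv.1) (inj uv.2)] by move=> uv [].
  elim=> [?|c d s {}v Kcd _]; first exact: chain_refl.
  apply: chain_trans; rewrite -!inj_psi; apply: psi_chain.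
  have inj_act e : inj (ract e s) = ract (inj e) s by [].
  by rewrite !inj_act; apply: chain_act; case: Kcd => /KR //= /chain_sym.
pose E : set (F * F) := [set uv | match uv.1.1, uv.2.1 with
  | inl i, inl j => chain K (i, uv.1.2) (j, uv.2.2)
  | inr _, inr _ => True
  | _, _ => False
  end].
have EC : is_congruence E.
  split.
  - by move=> [[i|x] s] //; exact: chain_refl.
  - by move=> [[i|x] s] [[j|y] t] //; exact: chain_sym.
  - by move=> [[i|x] s] [[j|y] t] [[k|z] r] //; exact: chain_trans.
  move=> [[i|x] s] [[j|y] t] r //; exact: chain_act.
have KE : K0 `<=` E.
  move=> [[[i|x] s] [[j|y] t]] K0st;
    have [[[/= Pu _] [/= Pv _]] _] := K0st => //.
  exact: chain_gen.
have := @chain_rep_rels _ _ H' Sg Sg_bounded P E EC KE (inj u) (inj v) isT isT.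
case: u v guv => i s [j t] guv; apply.
apply: chain_trans (inj_lft _) _; apply: chain_trans (lft_chain _ _ guv) _.
exact/chain_sym/inj_lft.
Qed.

Lemma quot_piP (S : monoidType) (A : rightActType S) (rho : congruence A)
    (a b : A) :
  (\pi_(quot_act rho)%qT a = \pi_(quot_act rho)%qT b) <-> cong_set rho (a, b).
Proof.
split=> [/eqmodP/set_mem //|ab]; exact/eqmodP/mem_set.
Qed.

Lemma right_coherentP (S : monoidType) :
  kernels_fin_gen S -> right_coherent S.
Proof.
move=> ker A [n [rho [[H [fH rhoE]] [f [[f' fK f'K] f_act]]]]] B [U [fU BE]].
have [us UE] : exists us : seq A, U = [set` us] by apply/finite_seqP.
pose m := size us; pose a (i : 'I_m) : A := tnth (in_tuple us) i.
pose g (i : 'I_m) : free_act S 'I_n := repr (f (a i)).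
have Ba u : subact_set B (ract (a u.1) u.2) by
  rewrite BE; exists (a u.1); [rewrite UE /=; exact: mem_tnth|exists u.2].
have [K fK' KE] := ker n m g H fH.
pose sigma : congruence (free_act S 'I_m) :=
  Congruence (chain_is_congruence K).
have piE u : f (ract (a u.1) u.2) =
    \pi_(quot_act rho)%qT (ract (g u.1) u.2).
  by rewrite f_act -[f (a u.1)]reprK; exact: quot_ract_pi.
have sigmaE u v : cong_set sigma (u, v) <-> ract (a u.1) u.2 = ract (a v.1) v.2.
  apply: iff_trans (KE u v) _.
  have -> : chain H (ract (g u.1) u.2) (ract (g v.1) v.2) <->
      cong_set rho (ract (g u.1) u.2, ract (g v.1) v.2).
    by rewrite rhoE smallest_congruenceE.
  rewrite -quot_piP -!piE; split=> [|-> //]; exact: (can_inj fK).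
have surj (b : subact_type B) : exists u, ract (a u.1) u.2 = val b.
  have BU x : subact_set B x -> subact_gen U x by rewrite BE.
  have := BU _ (set_mem (valP b)) => -[x + [s _ xs]].
  rewrite UE /= => /(tnthP (in_tuple us))[i xi].
  by exists (i, s); rewrite -xs xi.
pose pre b := projT1 (cid (surj b)).
have preE b : ract (a (pre b).1) (pre b).2 = val b.
  exact: projT2 (cid (surj b)).
exists m, sigma; split.
  by exists K; split=> //; rewrite smallest_congruenceE.
exists (fun b => \pi_(quot_act sigma)%qT (pre b)); split.
  pose back (q : quot_act sigma) : subact_type B :=
    SigSub (mem_set (Ba (repr q))).
  exists back => [b|q].
    apply: val_inj; rewrite /= -preE; apply/sigmaE/quot_piP.
    by rewrite reprK.
  rewrite -[RHS]reprK; apply/quot_piP/sigmaE.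
  by rewrite preE.
move=> b s; rewrite -[RHS]/(quot_ract _ _) quot_ract_pi.
apply/quot_piP/sigmaE; rewrite preE /= -preE -ractM; congr ract.
Qed.

Theorem theorem5p7 (Omega : Type) : right_coherent (FLA Omega).
Proof.
exact/right_coherentP/(@FLA_kernels_fin_gen {classic Omega}).
Qed.
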